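(* Let $n\ge 1$, let $\widetilde{\mathcal{W}}$ be an affine Weyl group acting on $\mathbb{R}^n$ with fundamental domain a foldable figure $C\subset\mathbb{R}^n$, let $\theta$ be any interior point of $C$, and let $A\in M_n(\mathbb{R})$ be any expansive matrix. Then there exists a dilation--reflection wavelet set for $(\widetilde{\mathcal{W}},\theta,A)$; that is, there exists a measurable set $E\subset\mathbb{R}^n$ such that (1) $E$ is $\widetilde{\mathcal{W}}$-congruent to $C$, and (2) $E$ generates a measurable partition of $\mathbb{R}^n$ under the action of the affine mapping $D(x):=A(x-\theta)+\theta$, i.e. $\{D^kE : k\in\mathbb{Z}\}$ is a measurable partition of $\mathbb{R}^n$.
   Context: All measure-theoretic notions are with respect to Lebesgue measure on $\mathbb{R}^n$, which carries its usual Euclidean structure. A real invertible $n\times n$ matrix $A$ is expansive if all its complex eigenvalues have modulus $>1$. Measurable partition: a countable family of measurable sets that are pairwise disjoint modulo null sets and whose union is the whole set modulo a null set. A fundamental domain for a countable group $\mathcal{G}$ of measurable transformations of $\mathbb{R}^n$ is a measurable set $C$ such that $\mathbb{R}^n\setminus\bigcup_{g\in\mathcal{G}}g(C)$ is null and $g_1(C)\cap g_2(C)$ is null whenever $g_1\ne g_2$. $\mathcal{G}$-congruence: for a countable group $\mathcal{G}$ of transformations, measurable sets $E,F$ are $\mathcal{G}$-congruent if there are measurable partitions $\{E_g : g\in\mathcal{G}\}$ of $E$ and $\{F_g: g\in\mathcal{G}\}$ of $F$ with $F_g=g(E_g)$ for all $g\in\mathcal{G}$, modulo null sets. Foldable figure: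 a compact connected set $C\subset\mathbb{R}^n$ (with nonempty interior) for which there is a finite set $\mathcal{S}$ of affine hyperplanes that cuts $C$ into finitely many congruent subfigures $C_1,\dots,C_m$, each similar to $C$, so that reflection in any of the cutting hyperplanes in $\mathcal{S}$ bounding $C_k$ takes it into some $C_\ell$. A foldable figure is a convex polytope. Affine Weyl group $\widetilde{\mathcal{W}}$ with fundamental domain the foldable figure $C$: the group of isometries of $\mathbb{R}^n$ generated by the orthogonal reflections about the affine hyperplanes of a locally finite collection, namely the group generated by the reflections about the bounding hyperplanes of $C$; the figure $C$ is a fundamental domain for $\widetilde{\mathcal{W}}$, i.e. $C$ tessellates $\mathbb{R}^n$ by reflections about its bounding hyperplanes. (The origin is not required to be a vertex of $C$.) *)

(* Defs.v *)
From mathcomp Require Import all_boot all_order all_algebra.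
From mathcomp Require Import complex.
From mathcomp Require Import all_classical all_reals all_analysis.

Set Implicit Arguments.
Unset Strict Implicit.
Unset Printing Implicit Defensive.

Import Order.TTheory GRing.Theory Num.Theory.
Import numFieldNormedType.Exports.

Local Open Scope classical_set_scope.
Local Open Scope ring_scope.

Section LebesgueMeasure.
Context {R : realType} {n : nat}.
Local Notation V := 'cV[R]_n.

Definition box (a b : V) : set V :=
  [set x | forall i, a i 0 <= x i 0 <= b i 0].

Definition box_volume (a b : V) : R := \prod_(i < n) (b i 0 - a i 0).

Definition lebesgue_outer (X : set V) : \bar R :=
  ereal_inf [set s | exists a b : nat -> V,
    [/\ forall k i, a k i 0 <= b k i 0,
        X `<=` \bigcup_k box (a k) (b k) &
        s = (\sum_(0 <= k <oo) (box_volume (a k) (b k))%:E)%E]].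

Definition lebesgue_measurable (X : set V) : Prop :=
  lebesgue_outer.-caratheodory X.

Definition null_set (X : set V) : Prop := lebesgue_outer X = 0%E.

Definition ae_equal (X Y : set V) : Prop :=
  null_set (X `+` Y).

(* The family (P i) indexed by the i in D. *)
Definition measurable_partition {I : Type} (D : set I) (P : I -> set V)
    (X : set V) : Prop :=
  [/\ countable D,
      forall i, D i -> lebesgue_measurable (P i),
      forall i j, D i -> D j -> i <> j -> null_set (P i `&` P j) &
      ae_equal (\bigcup_(i in D) P i) X].

End LebesgueMeasure.

Section TransformationGroups.
Context {R : realType} {n : nat}.
Local Notation V := 'cV[R]_n.

Definition transformation_group (G : set (V -> V)) : Prop :=
  [/\ G id,
      forall f g, G f -> G g -> G (f \o g) &
      forall f, G f -> exists2 g, G g & cancel f g /\ cancel g f].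

Definition generated_group (S : set (V -> V)) : set (V -> V) :=
  smallest transformation_group S.

Definition fundamental_domain (G : set (V -> V)) (C : set V) : Prop :=
  [/\ lebesgue_measurable C,
      null_set (~` \bigcup_(g in G) (g @` C)) &
      forall g1 g2, G g1 -> G g2 -> g1 <> g2 ->
        null_set ((g1 @` C) `&` (g2 @` C))].

Definition group_congruent (G : set (V -> V)) (E F : set V) : Prop :=
  exists E_ F_ : (V -> V) -> set V,
    [/\ measurable_partition G E_ E,
        measurable_partition G F_ F &
        forall g, G g -> ae_equal (F_ g) (g @` E_ g)].

End TransformationGroups.

Section FoldableFigures.
Context {R : realType} {n : nat}.
Local Notation V := 'cV[R]_n.

Definition dot (x y : V) : R := \sum_(i < n) x i 0 * y i 0.

Definition enorm (x : V) : R := Num.sqrt (dot x x).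

Definition hyperplane (v : V) (c : R) : set V := [set x | dot x v = c].

Definition affine_hyperplane (H : set V) : Prop :=
  exists v c, v != 0 /\ H = hyperplane v c.

Definition reflection (v : V) (c : R) (x : V) : V :=
  x - (2 * (dot x v - c) / dot v v) *: v.

(* As a map, [reflection v c] only depends on [hyperplane v c]. *)
Definition reflections (HH : set (set V)) : set (V -> V) :=
  [set s | exists v c,
    [/\ v != 0, HH (hyperplane v c) & s = reflection v c]].

Definition similitude (r : R) (f : V -> V) : Prop :=
  forall x y, enorm (f x - f y) = r * enorm (x - y).

Definition similar (X Y : set V) : Prop :=
  exists r f, [/\ 0 < r, similitude r f & f @` X = Y].

Definition congruent (X Y : set V) : Prop :=
  exists2 f, similitude 1 f & f @` X = Y.

(* C lies on one side of H and meets H in a facet, i.e. in a subset of H with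
   nonempty relative interior. *)
Definition bounding_hyperplane (C H : set V) : Prop :=
  (exists v c, [/\ v != 0, H = hyperplane v c & forall x, C x -> dot x v <= c])
  /\ exists2 p, H p & \forall x \near p, H x -> C x.

(* The subfigures into which the hyperplanes of S cut C: the closures of the
   connected components of what is left of C off the hyperplanes. *)
Definition subfigures (S : set (set V)) (C : set V) : set (set V) :=
  let X := C `\` \bigcup_(H in S) H in
  [set closure (connected_component X x) | x in X].

(* At least two subfigures are required: with a single one (e.g. S empty) every
   figure would be cut into a copy of itself. *)
Definition foldable_figure (C : set V) : Prop :=
  [/\ compact C, connected C, interior C !=set0 &
    exists S : set (set V),
      [/\ finite_set S /\ S `<=` affine_hyperplane,
          [/\ finite_set (subfigures S C),
              \bigcup_(P in subfigures S C) P = C &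
              exists P Q, [/\ subfigures S C P, subfigures S C Q & P <> Q]],
          forall P Q, subfigures S C P -> subfigures S C Q -> congruent P Q,
          forall P, subfigures S C P -> similar P C &
          forall P H s, subfigures S C P -> S H -> bounding_hyperplane P H ->
            reflections [set H] s ->
            exists2 Q, subfigures S C Q & s @` P `<=` Q]].

Definition locally_finite (HH : set (set V)) : Prop :=
  forall p : V, exists2 U, nbhs p U & finite_set [set H | HH H /\ H `&` U !=set0].

Definition affine_weyl_group (W : set (V -> V)) : Prop :=
  exists HH : set (set V),
    [/\ HH `<=` affine_hyperplane, locally_finite HH &
        W = generated_group (reflections HH)].

Definition affine_weyl_group_of (C : set V) (W : set (V -> V)) : Prop :=
  [/\ affine_weyl_group W,
      W = generated_group (reflections (bounding_hyperplane C)) &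
      fundamental_domain W C].

End FoldableFigures.

Section Dilations.
Context {R : realType} {n : nat}.
Local Notation V := 'cV[R]_n.

Definition expansive (A : 'M[R]_n) : Prop :=
  A \in unitmx /\
  forall z : R[i], eigenvalue (map_mx (real_complex R) A) z -> 1 < `|z|.

Definition dilation (A : 'M[R]_n) (theta x : V) : V :=
  A *m (x - theta) + theta.

(* For invertible A, the inverse of [dilation A theta] is
   [dilation (invmx A) theta]. *)
Definition dilation_iter (A : 'M[R]_n) (theta : V) (k : int) : V -> V :=
  match k with
  | Posz j => iter j (dilation A theta)
  | Negz j => iter j.+1 (dilation (invmx A) theta)
  end.

End Dilations.

(* Main.v *)
Require Import Defs.
From HB Require Import structures.
From mathcomp Require Import all_boot all_order all_algebra.
From mathcomp Require Import complex.
From mathcomp Require Import all_classical all_reals all_analysis.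
From mathcomp Require Import measurable_realfun ring lra.

Import Order.TTheory GRing.Theory Num.Theory.
Import numFieldNormedType.Exports.

Local Open Scope classical_set_scope.
Local Open Scope ring_scope.

(** Powers of [B = A^-1] tend to [0], so a finite sum [N] of the norms of
    [x], [B x], [B^2 x], etc. satisfies [N (B x) <= s * N x] with [s < 1].
    Hence [F = {x | N (B (x - theta)) < 1 <= N (x - theta)}] meets every orbit
    of the dilation [D] other than [{theta}] exactly once. On the one hand,
    [D^-j F] lies inside [C] for large [j]. On the other hand, [D^k F] contains
    arbitrarily large balls, and so contains some [w C] with [w] in [W], because
    the images of [C] cover almost everything and a ball is not null. Thus
    [D^-k w] embeds [C] into [F] and [D^-j] embeds [F] into [C], and the
    Cantor-Bernstein argument splits [C] into a part [B], to be moved by [w],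
    and a part [C \ B], to be left in place, such that [w B U (C \ B)] is both
    [W]-congruent to [C] and a transversal of the orbits of [D]. All the sets
    involved are Borel. *)

(** * The Lebesgue outer measure *)

Section OuterMeasure.
Context {R : realType}.

Lemma box_volume_ge0 {n} (a b : 'cV[R]_n) :
  (forall i, a i 0 <= b i 0) -> 0 <= box_volume a b.
Proof. by move=> ab; apply: prodr_ge0 => i _; rewrite subr_ge0. Qed.

Lemma lebesgue_outer_le {n} (X : set 'cV[R]_n) (a b : nat -> 'cV[R]_n) :
  (forall k i, a k i 0 <= b k i 0) -> X `<=` \bigcup_k box (a k) (b k) ->
  (lebesgue_outer X <= \sum_(0 <= k <oo) (box_volume (a k) (b k))%:E)%E.
Proof. by move=> ab Xab; apply: ereal_inf_lbound; exists a, b. Qed.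

Lemma le_lebesgue_outer {n} (X : set 'cV[R]_n) (z : \bar R) :
  (forall a b : nat -> 'cV[R]_n, (forall k i, a k i 0 <= b k i 0) ->
     X `<=` \bigcup_k box (a k) (b k) ->
     (z <= \sum_(0 <= k <oo) (box_volume (a k) (b k))%:E)%E) ->
  (z <= lebesgue_outer X)%E.
Proof.
by move=> H; apply: le_ereal_inf_tmp => _ [a [b [ab Xab ->]]]; exact: H.
Qed.

Lemma lebesgue_outer_ge0 {n} (X : set 'cV[R]_n) : (0 <= lebesgue_outer X)%E.
Proof.
apply: le_lebesgue_outer => a b ab _.
by apply: nneseries_ge0 => k _ _; rewrite lee_fin box_volume_ge0.
Qed.

Lemma lebesgue_outer_homo {n} :
  {homo @lebesgue_outer R n : A B / A `<=` B >-> (A <= B)%E}.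
Proof.
move=> A B AB; apply: le_lebesgue_outer => a b ab Bab.
by apply: lebesgue_outer_le => // x /AB /Bab.
Qed.

(** A point is a degenerate box, of volume zero because the dimension is positive; in dimension 0
    the empty product would give volume 1. *)
Lemma lebesgue_outer_set1 {n} (x : 'cV[R]_n.+1) : lebesgue_outer [set x] = 0%E.
Proof.
apply/eqP; rewrite eq_le lebesgue_outer_ge0 andbT.
have := @lebesgue_outer_le n.+1 [set x] (fun=> x) (fun=> x).
rewrite eseries0; first by apply=> // _ ->; exists 0%N => // i; rewrite lexx.
by move=> k _ _; rewrite /box_volume big_ord_recl subrr mul0r.
Qed.

Lemma lebesgue_outer_set0 {n} : lebesgue_outer (set0 : set 'cV[R]_n.+1) = 0%E.
Proof.
apply/eqP; rewrite eq_le lebesgue_outer_ge0 andbT.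
by rewrite -(lebesgue_outer_set1 (0 : 'cV_n.+1));
  apply: lebesgue_outer_homo; exact: sub0set.
Qed.

(** Covers of the [F k], each within [e / 2^(k+1)] of the infimum, are merged into one sequence of
    boxes through a bijection between [nat] and [nat * nat]. *)
Lemma lebesgue_outer_sigma_subadditive {n} :
  sigma_subadditive (@lebesgue_outer R n.+1).
Proof.
move=> F; have [[i ioo]|] := pselect (exists i, lebesgue_outer (F i) = +oo%E).
  rewrite (eseries_pinfty _ _ ioo) ?leey// => k _.
  by rewrite -ltNye (lt_le_trans _ (lebesgue_outer_ge0 _)).
rewrite -forallNE => Foo; apply/lee_addgt0Pr => e e0.
apply: le_trans
  (epsilon_trick xpredT (fun k => lebesgue_outer_ge0 (F k)) (ltW e0)).
pose P k (G : nat -> 'cV[R]_n.+1 * 'cV[R]_n.+1) :=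
  [/\ forall j i, (G j).1 i 0 <= (G j).2 i 0,
      F k `<=` \bigcup_j box (G j).1 (G j).2 &
      (\sum_(0 <= j <oo) (box_volume (G j).1 (G j).2)%:E <=
         lebesgue_outer (F k) + (e / (2 ^ k.+1)%:R)%:E)%E].
have [G PG] : {G & forall k, P k (G k)}.
  apply: (@choice _ _ P) => k.
  have en1 : 0 < e / (2 ^ k.+1)%:R by rewrite divr_gt0// ltr0n expn_gt0.
  have fF : lebesgue_outer (F k) \is a fin_num.
    rewrite ge0_fin_numE ?lebesgue_outer_ge0// ltey; exact/eqP/Foo.
  have [_ [a [b [ab Fab ->]]] /ltW ltab] := lb_ereal_inf_adherent en1 fF.
  by exists (fun j => (a j, b j)).
have /card_esym/ppcard_eqP[f] := card_nat2.
pose v (p : nat * nat) := (box_volume (G p.1 p.2).1 (G p.1 p.2).2)%:E.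
have v0 p : (0 <= v p)%E by rewrite lee_fin box_volume_ge0//; case: (PG p.1).
apply: (@le_trans _ _ (\sum_(0 <= k <oo) v (f k))%E).
  apply: lebesgue_outer_le; first by move=> k i; case: (PG (f k).1).
  move=> x [k _ /= Fx]; have [_ /(_ x Fx) [j _ xj] _] := PG k.
  by exists (f^-1%FUN (k, j)) => //=; rewrite invK// inE.
rewrite nneseries_esumT// -(@reindex_esum _ _ _ setT setT f v)//.
rewrite (_ : [set: nat * nat] = setT `*`` (fun=> setT)); last first.
  by apply/seteqP; split.
have /= <- := @esum_esum R nat nat setT (fun=> setT) (fun i j => v (i, j)).
  rewrite -nneseries_esumT; last by move=> k; exact: esum_ge0.
  apply: lee_nneseries => k _ ; first by move=> _; exact: esum_ge0.
  by rewrite -nneseries_esumT//; case: (PG k).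
by [].
Qed.

HB.instance Definition _ n := isOuterMeasure.Build R 'cV[R]_n.+1
  (@lebesgue_outer R n.+1) lebesgue_outer_set0 lebesgue_outer_ge0
  lebesgue_outer_homo lebesgue_outer_sigma_subadditive.

End OuterMeasure.

(** * Borel sets *)

Section Borel.
Context {R : realType}.

(** Every box of a cover is cut at height [t] across direction [i] into two boxes whose volumes add
    up. The cut [c k] is [t] clamped to the side of the box, so a box lying on one side of the
    hyperplane yields a degenerate second piece. *)
Lemma caratheodory_halfspace {n} (i : 'I_n.+1) (t : R) :
  lebesgue_outer.-caratheodory [set x : 'cV[R]_n.+1 | x i 0 <= t].
Proof.
apply: le_caratheodory_measurable => X; apply: le_lebesgue_outer => a b ab Xab.
pose upd (x : 'cV[R]_n.+1) c := \col_j (if j == i then c else x j 0).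
pose c k := Num.max (a k i 0) (Num.min (b k i 0) t).
have ac k : a k i 0 <= c k by rewrite le_max lexx.
have cb k : c k <= b k i 0 by rewrite ge_max ab ge_min lexx.
have vol k : (box_volume (a k) (b k))%:E =
    ((box_volume (a k) (upd (b k) (c k)))%:E +
     (box_volume (upd (a k) (c k)) (b k))%:E)%E.
  have volE (x y : 'cV[R]_n.+1) : box_volume x y =
      (y i 0 - x i 0) * \prod_(j < n.+1 | j != i) (y j 0 - x j 0).
    by rewrite /box_volume (bigD1 i).
  rewrite -EFinD; congr EFin; rewrite !volE !mxE eqxx.
  rewrite [X in _ + _ * X](eq_bigr (fun j => b k j 0 - a k j 0)); last first.
    by move=> j ji; rewrite !mxE (negbTE ji).
  rewrite [X in _ = _ * X + _](eq_bigr (fun j => b k j 0 - a k j 0));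
    last first.
    by move=> j ji; rewrite !mxE (negbTE ji).
  by ring.
have au k j : a k j 0 <= upd (b k) (c k) j 0.
  by rewrite mxE; case: eqP => [->|_].
have ub k j : upd (a k) (c k) j 0 <= b k j 0.
  by rewrite mxE; case: eqP => [->|_].
under eq_eseriesr do rewrite vol.
rewrite nneseriesD; [|by move=> k _ _; rewrite lee_fin box_volume_ge0..].
apply: leeD; apply: lebesgue_outer_le => // x [/Xab[k _ xk] /= xt];
  exists k => // j; rewrite mxE; case: eqP => [->|_]; have /andP[a1 b1] := xk j;
  rewrite ?a1 ?b1 ?andbT //=; have /andP[ai bi] := xk i.
- by rewrite ai le_max le_min bi xt orbT.
- rewrite bi andbT ge_max ai ge_min.
  by move/negP: xt; rewrite -ltNge => /ltW ->; rewrite orbT.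
Qed.

(** Borel sets are stable under preimages by continuous maps, so images under the isometries and
    dilations stay measurable without further work. *)
Definition borel {n} : set (set 'cV[R]_n) := <<s open >>.

Lemma borelC {n} (X : set 'cV[R]_n) : borel X -> borel (~` X).
Proof. by move=> bX; exact: (@measurableC _ (g_sigma_algebraType open)). Qed.

Lemma borelD {n} (X Y : set 'cV[R]_n) : borel X -> borel Y -> borel (X `\` Y).
Proof. by move=> bX bY; exact: (@measurableD _ (g_sigma_algebraType open)). Qed.

Lemma borelU {n} (X Y : set 'cV[R]_n) : borel X -> borel Y -> borel (X `|` Y).
Proof. by move=> bX bY; exact: (@measurableU _ (g_sigma_algebraType open)). Qed.

Lemma borel_bigcup {n} (F : nat -> set 'cV[R]_n) :
  (forall k, borel (F k)) -> borel (\bigcup_k F k).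
Proof.
by move=> bF; exact: (@bigcupT_measurable _ (g_sigma_algebraType open)).
Qed.

Lemma open_borel {n} (X : set 'cV[R]_n) : open X -> borel X.
Proof. by move=> oX; exact: sub_gen_smallest. Qed.

Lemma closed_borel {n} (X : set 'cV[R]_n) : closed X -> borel X.
Proof.
move=> cX; rewrite -(setCK X); apply: borelC; apply: open_borel.
by rewrite openC.
Qed.

Lemma borel_preimage {n} (f : 'cV[R]_n -> 'cV[R]_n) (X : set 'cV[R]_n) :
  continuous f -> borel X -> borel (f @^-1` X).
Proof.
move=> cf; apply: (@smallest_sub _ _ open [set Y | borel (f @^-1` Y)]).
- split => /=.
  + rewrite preimage_set0.
    exact: (@measurable0 _ (g_sigma_algebraType open)).
  + by move=> Y bY; rewrite setTD preimage_setC; exact: borelC.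
  + by move=> F bF; rewrite preimage_bigcup; exact: borel_bigcup.
- by move=> Y oY; apply: open_borel; move/continuousP: cf; apply.
Qed.

Lemma can_image {T : Type} {f g : T -> T} (X : set T) :
  cancel f g -> cancel g f -> f @` X = g @^-1` X.
Proof.
move=> fg gf; apply/seteqP; split => [_ [x Xx <-]|x Xx]; first by rewrite /= fg.
by exists (g x).
Qed.

Lemma borel_image {n} (f g : 'cV[R]_n -> 'cV[R]_n) (X : set 'cV[R]_n) :
  cancel f g -> cancel g f -> continuous g -> borel X -> borel (f @` X).
Proof.
by move=> fg gf cg bX; rewrite (can_image _ fg gf); exact: borel_preimage.
Qed.

Lemma mx_norm_leP {n} (x : 'cV[R]_n) (e : R) : 0 <= e ->
  reflect (forall i, `|x i 0| <= e) (`|x| <= e).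
Proof.
move=> e0; rewrite /Num.norm/= mx_normrE; apply: (iffP idP) => [xe i|H].
  by apply: le_trans xe; apply: (le_bigmax _ _ (i, 0)).
by apply/bigmax_leP; split => // -[i j] _ /=; rewrite (ord1 j); exact: H.
Qed.

Lemma le_coord_norm {n} (x : 'cV[R]_n) i : `|x i 0| <= `|x|.
Proof. by apply/mx_norm_leP. Qed.

(** An open set is a countable union of half-open boxes with rational corners, and such a box is a
    finite intersection of half-spaces and complements of half-spaces. *)
Lemma borel_measurable {n} (X : set 'cV[R]_n.+1) :
  borel X -> lebesgue_measurable X.
Proof.
apply: smallest_sub.
  split.
  - exact: caratheodory_measurable_set0.
  - by move=> A mA; rewrite setTD; exact: caratheodory_measurable_setC.
  - by move=> F mF; exact: caratheodory_measurable_bigcup.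
move=> U oU.
pose V := caratheodory_type (@lebesgue_outer R n.+1).
pose Q := ('cV[rat]_n.+1 * 'cV[rat]_n.+1)%type.
pose Bx (q : Q) : set 'cV[R]_n.+1 :=
  [set x | forall i, ratr (q.1 i 0) < x i 0 <= ratr (q.2 i 0)].
have -> : U = \bigcup_(q : Q) (if `[< Bx q `<=` U >] then Bx q else set0).
  apply/seteqP; split => [x Ux|x [q _]]; last first.
    by case: asboolP => // + xq; apply.
  have /nbhs_ballP[e /= e0 xeU] := open_nbhs_nbhs (conj oU Ux).
  have [p pP] : {p : 'I_n.+1 -> rat & forall i, x i 0 - e < ratr (p i) < x i 0}.
    apply: (@choice _ _ (fun i r => x i 0 - e < ratr r < x i 0)) => i.
    have : x i 0 - e < x i 0 by rewrite ltrBlDr ltrDl.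
    by move=> /rat_in_itvoo[r]; rewrite in_itv/=; exists r.
  have [q qP] : {q : 'I_n.+1 -> rat & forall i, x i 0 < ratr (q i) < x i 0 + e}.
    apply: (@choice _ _ (fun i r => x i 0 < ratr r < x i 0 + e)) => i.
    have : x i 0 < x i 0 + e by rewrite ltrDl.
    by move=> /rat_in_itvoo[r]; rewrite in_itv/=; exists r.
  exists (\col_i p i, \col_i q i) => //=; case: asboolP => [_|].
    move=> i /=; rewrite !mxE; have /andP[_ ->] := pP i.
    by have /andP[/ltW -> _] := qP i.
  case=> y yB; apply: xeU; split => // i j; rewrite (ord1 j).
  rewrite /ball/= ltr_distl; have := yB i; rewrite !mxE.
  have /andP[p1 p2] := pP i; have /andP[q1 q2] := qP i => /andP[y1 y2].
  by apply/andP; split; lra.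
apply: (@countable_bigcupT_measurable _ V); first exact: countableP.
move=> q; case: asboolP => _; last exact: measurable0.
have -> : Bx q = \bigcap_(i in [set: 'I_n.+1])
    (~` [set x : 'cV[R]_n.+1 | x i 0 <= ratr (q.1 i 0)] `&`
     [set x | x i 0 <= ratr (q.2 i 0)]).
  apply/seteqP; split => [x Bx_ i _|x H i]; first have /andP[] := Bx_ i.
    by move=> p1 p2; split => //=; apply/negP; rewrite -ltNge.
  by have [/= /negP] := H i I; rewrite -ltNge => -> ->.
apply: (@fin_bigcap_measurable _ V) => // i _.
apply: (@measurableI _ V); first apply: (@measurableC _ V);
  exact: caratheodory_halfspace.
Qed.

End Borel.

(** * Boxes have the expected measure *)

Section Positivity.
Context {R : realType}.

Let mu := @lebesgue_measure R.

Lemma lebesgue_measure_segment (a b : R) : a <= b ->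
  mu `[a, b]%classic = (b - a)%:E.
Proof.
move=> ab; rewrite /mu lebesgue_measure_itv /= lte_fin.
by case: ltgtP ab => // -> _; rewrite subrr.
Qed.

(* The weights make the induction on the dimension go through: slicing at
   [t] multiplies them by the indicator functions of the last sides. *)
Lemma box_cover_volume (n : nat) (c d : nat -> R) (w : nat -> R)
    (a b : nat -> nat -> R) :
  (forall i, c i <= d i) -> (forall k, 0 <= w k) ->
  (forall k i, a k i <= b k i) ->
  (forall x : nat -> R, (forall i, (i < n)%N -> c i <= x i <= d i) ->
     exists k, 1 <= w k /\ forall i, (i < n)%N -> a k i <= x i <= b k i) ->
  ((\prod_(i < n) (d i - c i))%:E <=
     \sum_(0 <= k <oo) (w k * \prod_(i < n) (b k i - a k i))%:E)%E.
Proof.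
move=> cd; elim: n w => [|n IH] w w0 ab cover.
  (* With no coordinate left, the hypothesis gives a weight at least 1, and this single term
     suffices. *)
  have [k [wk _]] := cover c (fun i => fun h => False_ind _ (notF h)).
  rewrite big_ord0 (@nneseriesD1 _ _ k)//; last first.
    by move=> j _; rewrite lee_fin big_ord0 mulr1.
  rewrite big_ord0 mulr1; apply: (@le_trans _ _ (w k)%:E).
    by rewrite lee_fin.
  by rewrite leeDl// nneseries_ge0// => j _ _; rewrite lee_fin big_ord0 mulr1.
pose P k := \prod_(i < n) (b k i - a k i).
have P0 k : 0 <= P k by apply: prodr_ge0 => i _; rewrite subr_ge0.
pose S k : set R := `[a k n, b k n]%classic.
pose D : set R := `[c n, d n]%classic.
have mS k : measurable (S k) by exact: measurable_itv.
have mD : measurable D by exact: measurable_itv.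
pose f k (t : R) : \bar R := ((w k * P k)%:E * (\1_(S k) t)%:E)%E.
have f0 k t : (0 <= f k t)%E.
  by rewrite /f -EFinM lee_fin !mulr_ge0.
have mI k : measurable_fun D (fun t => (\1_(S k) t)%:E : \bar R).
  by apply/measurable_EFinP; apply: measurable_indic.
have mf k : measurable_fun D (f k) by exact: measurable_funeM.
have slice t : D t ->
    ((\prod_(i < n) (d i - c i))%:E <= \sum_(0 <= k <oo) f k t)%E.
  rewrite /D/= in_itv/= => Dt.
  have := IH (fun k => w k * \1_(S k) t); rewrite /f.
  under eq_eseriesr do rewrite mulrAC EFinM.
  apply=> // [k|x xcd]; first by rewrite mulr_ge0.
  have [|k [wk xk]] := cover (fun i => if i == n then t else x i).
    move=> i; rewrite ltnS leq_eqVlt; case: eqVneq => [->//|_ /=]; exact: xcd.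
  exists k; split.
    have := xk n (ltnSn n); rewrite eqxx => tk.
    by rewrite indicE mem_set ?mulr1// /S/= in_itv.
  move=> i ilt; have := xk i (leqW ilt); rewrite ifF//.
  by apply/negbTE; rewrite neq_ltn ilt.
rewrite big_ord_recr/= EFinM.
(* Integrate [slice] over the last side [D], exchange sum and integral, and bound the measure of
   [S k] within [D] by the length of [S k]. *)
apply: (@le_trans _ _ (\int[mu]_(t in D) (\prod_(i < n) (d i - c i))%:E)%E).
  by rewrite integral_cst// -(lebesgue_measure_segment _ _ (cd n)).
apply: (@le_trans _ _ (\int[mu]_(t in D) (\sum_(0 <= k <oo) f k t))%E).
  apply: ge0_le_integral => //.
  - by move=> t _; rewrite lee_fin; apply: prodr_ge0 => i _; rewrite subr_ge0.
  - by apply: (@ge0_emeasurable_sum _ _ _ D f xpredT) => [k t _ _|k _];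
      [exact: f0|exact: mf].
rewrite integral_nneseries//; apply: lee_nneseries => k _.
  by move=> _; apply: integral_ge0 => t _.
rewrite ge0_integralZl//; last 2 first.
- exact: mI.
- by rewrite lee_fin mulr_ge0.
rewrite integral_indic; [|exact: mD|exact: mS].
rewrite big_ord_recr/= -/(P k) mulrA [leRHS]EFinM.
apply: lee_wpmul2l; first by rewrite lee_fin mulr_ge0.
rewrite -lebesgue_measure_segment//; apply: le_measure;
  rewrite ?inE; [|exact: mS|exact: subIsetl].
by apply: measurableI; [exact: mS|exact: mD].
Qed.

Lemma box_volume_le_outer {n} (c d : 'cV[R]_n) :
  (forall i, c i 0 <= d i 0) ->
  ((box_volume c d)%:E <= lebesgue_outer (box c d))%E.
Proof.
move=> cd; apply: le_lebesgue_outer => a b ab cover.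
pose ext (x : 'cV[R]_n) (i : nat) : R := if insub i is Some j then x j 0 else 0.
have extE x (i : 'I_n) : ext x i = x i 0 by rewrite /ext valK.
have ext_le (x y : 'cV[R]_n) : (forall i, x i 0 <= y i 0) ->
    forall i, ext x i <= ext y i.
  by move=> xy i; rewrite /ext; case: insubP.
have volE x y : box_volume x y = \prod_(i < n) (ext y i - ext x i).
  by apply: eq_bigr => i _; rewrite !extE.
rewrite volE; under eq_eseriesr do rewrite volE -[X in X%:E]mul1r.
apply: (@box_cover_volume n (ext c) (ext d) (fun=> 1)
  (fun k => ext (a k)) (fun k => ext (b k))) => //; try exact: ext_le.
  by move=> k; exact: ext_le.
move=> x xcd; have [|k _ xk] := cover (\col_i x i).
  by move=> i; rewrite mxE -!extE; exact: xcd.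
exists k; split=> // i ilt; have := xk (Ordinal ilt).
by rewrite mxE -!extE.
Qed.

Lemma lebesgue_outer_nbhs_gt0 {n} (X : set 'cV[R]_n) (x : 'cV[R]_n) :
  nbhs x X -> (0 < lebesgue_outer X)%E.
Proof.
move=> /nbhs_ballP[e /= e0 xeX].
pose c : 'cV[R]_n := \col_i (x i 0 - e / 2).
pose d : 'cV[R]_n := \col_i (x i 0 + e / 2).
apply: (@lt_le_trans _ _ (box_volume c d)%:E).
  by rewrite lte_fin; apply: prodr_gt0 => i _; rewrite !mxE; lra.
apply: (@le_trans _ _ (lebesgue_outer (box c d))).
  by apply: box_volume_le_outer => i; rewrite !mxE; lra.
apply: lebesgue_outer_homo => y yB; apply: xeX; split=> // i j; rewrite (ord1 j).
rewrite /ball/= ltr_distl; have /andP[] := yB i; rewrite !mxE => ? ?.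
by apply/andP; split; lra.
Qed.

End Positivity.

(** * Powers of the inverse of an expansive matrix *)

Section Spectral.
Context {R : realType}.
Local Notation normc := (@Normc.normc R).

Lemma complex_normE (z : R[i]) : `|z| = (normc z)%:C%C.
Proof. by []. Qed.

Lemma normc_ge0 (z : R[i]) : 0 <= normc z.
Proof. by rewrite -lecR -complex_normE normr_ge0. Qed.

Lemma normc_real (x : R) : normc (x%:C%C) = `|x|.
Proof. by rewrite /Normc.normc/= expr0n/= addr0 sqrtr_sqr. Qed.

Definition geometric_decay {p q} (Y : nat -> 'M[R[i]]_(p, q)) :=
  exists M r : R, [/\ 0 <= M, 0 <= r, r < 1 &
    forall k i j, normc (Y k i j) <= M * r ^+ k].

Lemma geometric_decay_recurrence {p q} (Y Z : nat -> 'M[R[i]]_(p, q)) (l : R[i]) :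
  normc l < 1 -> (forall k, Y k.+1 = l *: Y k + Z k) ->
  geometric_decay Z -> geometric_decay Y.
Proof.
move=> l1 YZ [M [s [M0 s0 s1 Zs]]]; have l0 := normc_ge0 l.
(* This rate satisfies [s <= r < 1] and exceeds [normc l] by [dl]. The term [M / dl] of the constant
   makes this gap absorb the contribution of [Z], as [(M / dl) * dl = M]. *)
pose r := 1 - (1 - s) * (1 - normc l) / 2.
pose dl := (1 - normc l) * (1 + s) / 2.
have dl0 : 0 < dl by rewrite divr_gt0// mulr_gt0//; lra.
have rE : r = normc l + dl by rewrite /r /dl; field.
have sr : s <= r.
  rewrite -subr_ge0.
  suff -> : r - s = (1 - s) * (1 + normc l) / 2.
    by rewrite divr_ge0// mulr_ge0//; lra.
  by rewrite /r; field.
have r1 : r < 1.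
  by rewrite /r ltrBlDr ltrDl divr_gt0// mulr_gt0//; lra.
pose S := \sum_i \sum_j normc (Y 0%N i j).
have YS i j : normc (Y 0%N i j) <= S.
  rewrite /S (bigD1 i)//= (bigD1 j)//= -addrA lerDl addr_ge0//.
    by apply: sumr_ge0 => *; exact: normc_ge0.
  by apply: sumr_ge0 => *; apply: sumr_ge0 => *; exact: normc_ge0.
have S0 : 0 <= S.
  by apply: sumr_ge0 => *; apply: sumr_ge0 => *; exact: normc_ge0.
have Md0 : 0 <= M / dl by rewrite divr_ge0// ltW.
exists (S + M / dl), r; split => //; [by lra|by lra|].
move=> k i j; elim: k => [|k IH].
  by rewrite expr0 mulr1 (le_trans (YS i j))// lerDl.
rewrite YZ !mxE (le_trans (le_normcD _ _))// Normc.normcM.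
have r0 : 0 <= r ^+ k by apply: exprn_ge0; lra.
have Zr : normc (Z k i j) <= M * r ^+ k.
  by apply: (le_trans (Zs k i j)); rewrite ler_wpM2l// lerXn2r ?nnegrE//; lra.
apply: (@le_trans _ _ (normc l * ((S + M / dl) * r ^+ k) + M * r ^+ k)).
  by rewrite lerD// ler_wpM2l.
rewrite exprS -subr_ge0; move: (r ^+ k) r0 => t t0.
suff -> : (S + M / dl) * (r * t) - (normc l * ((S + M / dl) * t) + M * t) =
    S * dl * t.
  by rewrite mulr_ge0// mulr_ge0// ltW.
by rewrite rE; field; rewrite gt_eqF.
Qed.

(* The factors [B - z] are removed one at a time, through the recurrence
   [B^(k+1) C = z B^k C + B^k (B - z) C]. *)
Lemma geometric_decay_annihilator {n} (B : 'M[R[i]]_n.+1) (s : seq R[i])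
    (C : 'M[R[i]]_n.+1) :
  (forall z, z \in s -> normc z < 1) ->
  (\prod_(z <- s) (B - z%:M)) * C = 0 ->
  geometric_decay (fun k => B ^+ k * C).
Proof.
elim/last_ind: s C => [|s z IH] C sz.
  rewrite big_nil mul1r => ->; exists 0, 0; split => // k i j.
  by rewrite mulr0 mxE mul0r Normc.normc0.
rewrite big_rcons/= -mulrA => /IH H.
apply: (@geometric_decay_recurrence _ _ _ (fun k => B ^+ k * ((B - z%:M) * C)) z).
- by apply: sz; rewrite mem_rcons mem_head.
- move=> k; have zB : B ^+ k * (z%:M * C) = z *: (B ^+ k * C).
    by rewrite -[z%:M * C]/(z%:M *m C) mul_scalar_mx scalerAr.
  by rewrite mulrBl mulrBr zB mulrA -exprSr addrC subrK.
- by apply: H => y ys; apply: sz; rewrite mem_rcons inE ys orbT.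
Qed.

(** The characteristic polynomial splits over the complex numbers, and by Cayley-Hamilton the
    product of the [B - z] over its roots vanishes. *)
Lemma geometric_decay_spectrum {n} (B : 'M[R[i]]_n.+1) :
  (forall z, eigenvalue B z -> normc z < 1) -> geometric_decay (fun k => B ^+ k).
Proof.
move=> Bz; have [s sE] := closed_field_poly_normal (char_poly B).
rewrite (monicP (char_poly_monic B)) scale1r in sE.
have [||M [r [M0 r0 r1 Mr]]] := @geometric_decay_annihilator n B s 1 _ _.
- move=> z zs; apply: Bz; rewrite eigenvalue_root_char sE.
  by rewrite root_prod_XsubC.
- rewrite mulr1 -(Cayley_Hamilton B) sE rmorph_prod; apply: eq_bigr => z _ /=.
  by rewrite rmorphB/= horner_mx_X horner_mx_C.
by exists M, r; split => // k i j; rewrite -[B ^+ k]mulr1.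
Qed.

(** An eigenvector of the inverse for [z] is one of [A] for [z^-1], so all eigenvalues of the
    inverse have modulus less than 1. *)
Lemma expansive_inv_decay {n} (A : 'M[R]_n.+1) : expansive A ->
  exists M r : R, [/\ 0 <= M, 0 <= r, r < 1 &
    forall k i j, `|((invmx A) ^+ k) i j| <= M * r ^+ k].
Proof.
move=> [uA Az].
pose B := map_mx (real_complex R) (invmx A).
have AB : map_mx (real_complex R) A *m B = 1%:M.
  by rewrite -map_mxM mulmxV// map_mx1.
have BA : B *m map_mx (real_complex R) A = 1%:M.
  by rewrite -map_mxM mulVmx// map_mx1.
have [|M [r [M0 r0 r1 Mr]]] := @geometric_decay_spectrum n B.
  move=> z /eigenvalueP[v vB v0].
  have z0 : z != 0.
    apply: contraNneq v0 => z0; move: vB; rewrite z0 scale0r => vB.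
    by rewrite -[v]mulmx1 -BA mulmxA vB mul0mx.
  have /Az : eigenvalue (map_mx (real_complex R) A) z^-1.
    apply/eigenvalueP; exists v => //.
    rewrite -[v in RHS]mulmx1 -BA mulmxA vB -scalemxAl scalerA mulVf// scale1r.
    by [].
  rewrite normfV invf_gt1 ?normr_gt0// complex_normE.
  by rewrite -[1]/(1%:C%C) ltcR.
exists M, r; split => // k i j.
by rewrite -normc_real; have := Mr k i j; rewrite -rmorphXn/= mxE.
Qed.

End Spectral.

(** * Dilations *)

Section Dilation.
Context {R : realType}.

Lemma exists_expr_lt (r e : R) : 0 <= r -> r < 1 -> 0 < e ->
  exists k : nat, r ^+ k < e.
Proof.
move=> r0 r1 e0; have r1' : `|r| < 1 by rewrite ger0_norm.
have /cvgrPdist_lt/(_ e e0) [k _ /(_ k (leqnn k))] := cvg_expr r1'.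
by rewrite /= sub0r normrN ger0_norm ?exprn_ge0// => ?; exists k.
Qed.

Lemma mulmx_norm_le {m n} (B : 'M[R]_(m, n)) (x : 'cV[R]_n) (M : R) :
  0 <= M -> (forall i j, `|B i j| <= M) -> `|B *m x| <= n%:R * M * `|x|.
Proof.
move=> M0 BM; apply/mx_norm_leP; first by rewrite !mulr_ge0.
move=> i; rewrite mxE (le_trans (ler_norm_sum _ _ _))//.
apply: (@le_trans _ _ (\sum_(j < n) M * `|x|)).
  by apply: ler_sum => j _; rewrite normrM ler_pM// le_coord_norm.
by rewrite sumr_const card_ord -mulrA mulr_natl.
Qed.

(* [N x] is the sum of the norms of [x], [B x], ..., [B^m x], where
   [B] is the inverse of [A] and [B^(m+1)] halves norms. *)
Lemma adapted_norm {n} (A : 'M[R]_n.+1) : expansive A ->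
  exists (N : 'cV[R]_n.+1 -> R) (K s : R),
    [/\ [/\ forall x y, N (x + y) <= N x + N y,
            forall a x, N (a *: x) = `|a| * N x,
            forall x, `|x| <= N x & forall x, N x <= K * `|x|],
        0 < K, 0 < s < 1 &
        forall x, N (invmx A *m x) <= s * N x].
Proof.
move=> /expansive_inv_decay[M [r [M0 r0 r1 Mr]]]; set B := invmx A.
pose c k := n.+1%:R * (M * r ^+ k).
have c0 k : 0 <= c k by rewrite !mulr_ge0// exprn_ge0.
have Bc k (x : 'cV[R]_n.+1) : `|B ^+ k *m x| <= c k * `|x|.
  by rewrite /c; apply: mulmx_norm_le => //; rewrite mulr_ge0// exprn_ge0.
have [m cm] : exists m, c m.+1 <= 1 / 2.
  have e0 : 0 < 1 / 2 / (n.+1%:R * M + 1) :> R.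
    by rewrite divr_gt0// ltr_wpDl// mulr_ge0.
  have [m] := exists_expr_lt _ _ r0 r1 e0.
  rewrite ltr_pdivlMr ?ltr_wpDl ?mulr_ge0// => rm; exists m.
  apply: le_trans (ltW rm); rewrite /c mulrA [leRHS]mulrC.
  apply: ler_pM => //; rewrite ?mulr_ge0 ?exprn_ge0 ?lerDl//.
  by rewrite exprS ler_piMl ?exprn_ge0// ltW.
pose N (x : 'cV[R]_n.+1) := \sum_(i < m.+1) `|B ^+ i *m x|.
pose K := \sum_(i < m.+1) c i + 1.
have K0 : 0 < K by rewrite ltr_wpDl// sumr_ge0.
have NK x : N x <= K * `|x|.
  rewrite mulrDl mulr_suml (@le_trans _ _ (\sum_(i < m.+1) c i * `|x|))//.
    by apply: ler_sum => i _.
  by rewrite lerDl mul1r.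
have xN x : `|x| <= N x.
  by rewrite /N big_ord_recl expr0 mul1mx lerDl sumr_ge0.
have K1 : 1 <= K by rewrite lerDr sumr_ge0.
(* By telescoping, [N (B x) = N x - |x| + |B^(m+1) x| <= N x - |x| / 2], and [|x| >= N x / K] yields
   the factor. The summand 1 in [K] ensures [K >= 1], hence a positive factor. *)
exists N, K, (1 - (2 * K)^-1); split => //.
- split => // [x y|a x].
    rewrite -big_split/=; apply: ler_sum => i _.
    by rewrite mulmxDr ler_normD.
  by rewrite mulr_sumr; apply: eq_bigr => i _; rewrite -scalemxAr normrZ.
- have K2 : 0 < (2 * K)^-1 by rewrite invr_gt0 mulr_gt0.
  apply/andP; split; last by rewrite ltrBlDr ltrDl.
  by rewrite subr_gt0 invf_lt1 ?mulr_gt0//; lra.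
- move=> x; rewrite mulrBl mul1r.
  have NB : N (B *m x) + `|x| = N x + `|B ^+ m.+1 *m x|.
    rewrite /N big_ord_recr [in RHS]big_ord_recl/= expr0 mul1mx.
    rewrite mulmxA -[_ *m B]/(B ^+ m * B) -exprSr [LHS]addrC addrA; congr (_ + _ + _).
    by apply: eq_bigr => i _; rewrite mulmxA -[_ *m B]/(B ^+ i * B) -exprSr.
  have Nx : (2 * K)^-1 * N x <= 1 / 2 * `|x|.
    rewrite mul1r invfM -mulrA ler_wpM2l ?invr_ge0//.
    by rewrite mulrC ler_pdivrMr// mulrC.
  have Bm : `|B ^+ m.+1 *m x| <= 1 / 2 * `|x|.
    by apply: (le_trans (Bc _ _)); rewrite ler_wpM2r.
  by lra.
Qed.

Lemma lipschitz_continuous {V U : normedModType R} (K : R) (f : V -> U) :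
  (forall x y, `|f x - f y| <= K * `|x - y|) -> continuous f.
Proof.
move=> fK x; apply/cvgrPdist_lt => e e0; near=> y.
have K1 : 0 < `|K| + 1 by rewrite ltr_wpDl.
apply: (le_lt_trans (fK x y)).
apply: (@le_lt_trans _ _ ((`|K| + 1) * `|x - y|)).
  by rewrite ler_wpM2r// (le_trans (ler_norm _))// lerDl.
rewrite mulrC -ltr_pdivlMr//; near: y.
by apply: cvgr_dist_lt; rewrite ?divr_gt0//; exact: cvg_id.
Unshelve. all: by end_near. Qed.

Section Iter.
Context {n : nat} (A : 'M[R]_n.+1) (theta : 'cV[R]_n.+1) (uA : A \in unitmx).
Local Notation D := (dilation_iter A theta).

Lemma dilation_iterE k x : D k x = (A ^ k) *m (x - theta) + theta.
Proof.
have iterE (B : 'M[R]_n.+1) j :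
    iter j (dilation B theta) x = B ^+ j *m (x - theta) + theta.
  elim: j => [|j IH]; first by rewrite expr0 mul1mx subrK.
  by rewrite iterS IH /dilation addrK mulmxA exprS.
case: k => j /=; first by rewrite iterE.
by rewrite -iterS iterE NegzE -exprz_inv.
Qed.

Lemma dilation_iterD k l x : D (k + l) x = D k (D l x).
Proof. by rewrite !dilation_iterE addrK mulmxA exprzDr. Qed.

Lemma dilation_iterK k : cancel (D k) (D (- k)).
Proof. by move=> x; rewrite -dilation_iterD addNr. Qed.

Lemma dilation_iterNK k : cancel (D (- k)) (D k).
Proof. by move=> x; rewrite -dilation_iterD addrN. Qed.

Lemma continuous_dilation_iter k : continuous (D k).
Proof.
pose M := \sum_i \sum_j `|(A ^ k) i j|.
apply: (@lipschitz_continuous _ _ (n.+1%:R * M)) => x y.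
rewrite !dilation_iterE opprD addrACA subrr addr0 -mulmxBr opprB addrA subrK.
have sg i : 0 <= \sum_j `|(A ^ k) i j| by apply: sumr_ge0.
apply: mulmx_norm_le => [|i j]; first by apply: sumr_ge0.
by rewrite /M (bigD1 i)//= (bigD1 j)//= -addrA lerDl addr_ge0// sumr_ge0.
Qed.

End Iter.

End Dilation.

(** * A Borel transversal for the orbits of the dilation *)

Section Tile.
Context {R : realType}.

(** Along an orbit, [phi y m = N (A^m y)] shrinks at least by the factor [s] with each step back, so
    for [y != 0] it crosses the level 1 exactly once; [F] collects the points just past the
    crossing. The last two clauses provide the embeddings of [F] into [C] and of [C] into [F]. *)
Lemma dilation_tile {n} (A : 'M[R]_n.+1) (theta : 'cV[R]_n.+1) : expansive A ->
  exists F : set 'cV[R]_n.+1,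
    [/\ borel F,
        forall x, x <> theta -> exists k, F (dilation_iter A theta k x),
        forall x k l, F (dilation_iter A theta k x) ->
          F (dilation_iter A theta l x) -> k = l,
        forall e, 0 < e -> exists j, forall x, F x ->
          `|dilation_iter A theta (- j) x - theta| < e &
        forall r, 0 < r -> exists k p, forall z, `|z - p| <= r ->
          F (dilation_iter A theta (- k) z)].
Proof.
move=> expA; have uA := expA.1.
have [N [K [s [[ND NZ xN NK] K0 /andP[s0 s1] NB]]]] := adapted_norm A expA.
have NN x : N (- x) = N x by rewrite -scaleN1r NZ normrN1 mul1r.
have N0 x : 0 <= N x by exact: le_trans (xN x).
have Ndist x y : `|N x - N y| <= N (x - y).
  rewrite ler_norml; apply/andP; split.
    by have := ND (y - x) x; rewrite subrK -opprB NN; lra.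
  by have := ND (x - y) y; rewrite subrK; lra.
pose phi y (m : int) := N (A ^ m *m y).
have phi_step y m : phi y (m - 1) = N (invmx A *m (A ^ m *m y)).
  by rewrite /phi addrC exprzDr// mulmxA.
have phi_le y m (k : nat) : phi y (m - k%:Z) <= s ^+ k * phi y m.
  elim: k => [|k IH]; first by rewrite subr0 expr0 mul1r.
  rewrite -addn1 PoszD opprD addrA phi_step (le_trans (NB _))//.
  by rewrite addn1 exprS -mulrA ler_wpM2l// ltW.
pose F := [set x | 1 <= N (x - theta)] `\`
  [set x | 1 <= N (invmx A *m (x - theta))].
have DE k x : dilation_iter A theta k x - theta = A ^ k *m (x - theta).
  by rewrite dilation_iterE// addrK.
have FD x k : F (dilation_iter A theta k x) <->
    1 <= phi (x - theta) k /\ phi (x - theta) (k - 1) < 1.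
  rewrite /F /= !DE phi_step; split=> -[? H]; split => //.
    by rewrite ltNge; apply/negP.
  by apply/negP; rewrite -ltNge.
exists F; split.
- have borelN (f : 'cV[R]_n.+1 -> R) :
      (forall x y, `|f x - f y| <= K * `|x - y|) -> borel [set x | 1 <= f x].
    move=> fK; apply: closed_borel.
    apply: (@closed_comp _ _ f [set t | 1 <= t]); last exact: closed_ge.
    by move=> x _; exact: (@lipschitz_continuous _ _ R^o K f fK x).
  apply: borelD; apply: borelN => x y.
    by apply: (le_trans (Ndist _ _)); rewrite opprB addrA subrK.
  apply: (le_trans (Ndist _ _)); rewrite -mulmxBr opprB addrA subrK.
  apply: (le_trans (NB _)); apply: le_trans (NK _).
  by rewrite ler_piMl// ltW.
- move=> x /eqP; rewrite -subr_eq0; set y := x - theta => y0.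
  have Ny0 : 0 < N y by apply: lt_le_trans (xN y); rewrite normr_gt0.
  have [j sj] : exists j, s ^+ j < (N y)^-1.
    by apply: exists_expr_lt; rewrite ?invr_gt0// ltW.
  have [m sm] : exists m, s ^+ m < N y.
    by apply: exists_expr_lt => //; rewrite ltW.
  have phi0 : phi y 0 = N y by rewrite /phi expr0z mul1mx.
  (* Shifting by [j] turns the search for the crossing into one over [nat]: [phi y (- j) < 1]
     excludes the minimum 0, and [phi y m >= 1] bounds the search. *)
  have exP : exists k : nat, 1 <= phi y (k%:Z - j%:Z).
    exists (m + j)%N; rewrite PoszD addrK leNgt; apply/negP => phi1.
    have := phi_le y m m; rewrite subrr phi0 leNgt => /negP; apply.
    by apply: le_lt_trans sm; rewrite ler_piMr// ?exprn_ge0// ltW.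
  have [[|k] Pk kmin] := ex_minnP exP.
    have := phi_le y 0 j; rewrite phi0 leNgt => /negP[].
    by apply: lt_le_trans Pk; rewrite -ltr_pdivlMr// mul1r.
  exists (k.+1%:Z - j%:Z); apply/FD; split => //.
  rewrite ltNge; apply/negP; rewrite addrAC -(addn1 k) PoszD addrK => /kmin.
  by rewrite ltnn.
- move=> x k l /FD[k1 k2] /FD[l1 l2].
  have H (a b : int) : a < b -> 1 <= phi (x - theta) a ->
      phi (x - theta) (b - 1) < 1 -> False.
    move=> ab a1 b1; have [p pE] : exists p : nat, b - 1 - a = p%:Z.
      by exists (absz (b - 1 - a)%R); rewrite gez0_abs// subr_ge0 lerBrDr lezD1.
    have := phi_le (x - theta) (b - 1) p.
    have -> : b - 1 - p%:Z = a by rewrite -pE opprB addrC subrK.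
    move=> /(le_trans a1); rewrite leNgt => /negP; apply.
    apply: le_lt_trans b1; rewrite ler_piMl ?N0// exprn_ile1// ltW//.
  by case: (ltgtP k l) => // kl; [case: (H k l)|case: (H l k)].
- move=> e e0; have [j sj] := exists_expr_lt _ _ (ltW s0) s1 e0.
  (* One extra step, since on [F] the upper bound 1 holds only for [phi] at -1. *)
  exists (j%:Z + 1) => x [_ /negP]; rewrite -ltNge => x1.
  have phi1 : phi (x - theta) (-1) < 1.
    by rewrite -[-1]add0r phi_step expr0z mul1mx.
  have -> : - (j%:Z + 1) = -1 - j%:Z by rewrite opprD addrC.
  apply: (le_lt_trans (xN _)); rewrite DE.
  apply: (le_lt_trans (phi_le _ _ _)); apply: le_lt_trans sj.
  by rewrite ler_piMr ?exprn_ge0// ltW.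
- move=> r r0; pose y0 : 'cV[R]_n.+1 := const_mx 1.
  have Ny0 : 0 < N y0.
    apply: lt_le_trans (xN y0); rewrite normr_gt0; apply/eqP => /matrixP/(_ 0 0).
    by rewrite !mxE => /eqP; rewrite oner_eq0.
  (* If [N y1 = 1 + dl] and [N (u - y1) <= dl], then [N u >= 1] and
     [N (B u) <= s * (1 + 2 * dl) < 1], where [B] is the inverse of [A]. So [F] contains a translate
     of this [N]-ball, which [A^k] expands until it contains a ball of radius [r]. *)
  pose dl := (1 - s) / 4; have dl0 : 0 < dl by rewrite /dl; lra.
  pose y1 := ((1 + dl) / N y0) *: y0.
  have Ny1 : N y1 = 1 + dl.
    rewrite NZ ger0_norm ?divfK ?gt_eqF//.
    by rewrite divr_ge0// ltW//; lra.
  have [k sk] : exists k, s ^+ k < dl / (K * r).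
    by apply: (exists_expr_lt _ _ (ltW s0) s1); rewrite divr_gt0// mulr_gt0.
  exists k%:Z, (dilation_iter A theta k (y1 + theta)) => z zp.
  set u := A ^ (- k%:Z) *m (z - theta).
  have uy : N (u - y1) <= dl.
    have -> : u - y1 = A ^ (- k%:Z) *m (z - dilation_iter A theta k (y1 + theta)).
      rewrite dilation_iterE// addrK opprD addrA addrAC mulmxBr mulmxA.
      by rewrite -[_ *m (A ^ k)]/(_ * A ^ k) -exprzDr// addNr expr0z mul1mx.
    rewrite -[- k%:Z]sub0r (le_trans (phi_le _ _ _))//.
    rewrite /phi expr0z mul1mx; move: sk; rewrite ltr_pdivlMr ?mulr_gt0// => /ltW.
    apply: le_trans; apply: ler_wpM2l; first by rewrite exprn_ge0// ltW.
    by apply: (le_trans (NK _)); rewrite ler_wpM2l// ltW.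
  have u1 : 1 <= N u.
    by have := ND (y1 - u) u; rewrite subrK Ny1 -opprB NN; lra.
  apply/FD; split; first exact: u1.
  rewrite phi_step -/u -[u](subrK y1) mulmxDr.
  apply: (le_lt_trans (ND _ _)).
  have := NB (u - y1); have := NB y1; rewrite Ny1 => h1 h2.
  have h3 : s * N (u - y1) <= s * dl by rewrite ler_wpM2l// ltW.
  have h4 : s * dl < dl by rewrite gtr_pMl.
  have h5 : dl * 4 = 1 - s by rewrite /dl divfK.
  by rewrite mulrDr mulr1 in h1; lra.
Qed.

End Tile.

(** * Euclidean isometries *)

Section Euclid.
Context {R : realType} {n : nat}.
Implicit Types x y u v : 'cV[R]_n.

Lemma dot_ge0 x : 0 <= dot x x.
Proof. by apply: sumr_ge0 => i _; rewrite -expr2 sqr_ge0. Qed.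

Lemma dot_gt0 v : v != 0 -> 0 < dot v v.
Proof.
move=> v0; rewrite lt_neqAle dot_ge0 andbT eq_sym; apply: contra v0.
rewrite psumr_eq0 => [/allP v0|i _]; last by rewrite -expr2 sqr_ge0.
apply/eqP/colP => i; rewrite mxE; apply/eqP.
by have := v0 i (mem_index_enum i); rewrite mulf_eq0 orbb.
Qed.

Lemma dotBl x y v : dot (x - y) v = dot x v - dot y v.
Proof.
rewrite /dot -sumrB; apply: eq_bigr => i _.
by rewrite !mxE mulrBl.
Qed.

Lemma dotZl a x v : dot (a *: x) v = a * dot x v.
Proof. by rewrite /dot mulr_sumr; apply: eq_bigr => i _; rewrite mxE mulrA. Qed.

Lemma dotC x y : dot x y = dot y x.
Proof. by apply: eq_bigr => i _; rewrite mulrC. Qed.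

Lemma dot_subZ u v a :
  dot (u - a *: v) (u - a *: v) = dot u u - 2 * a * dot u v + a ^+ 2 * dot v v.
Proof.
rewrite dotBl dotZl (dotC u) (dotC v) !dotBl !dotZl (dotC v u).
by ring.
Qed.

Lemma reflection_isometry v c x y : v != 0 ->
  enorm (reflection v c x - reflection v c y) = enorm (x - y).
Proof.
move=> /dot_gt0 v0; congr Num.sqrt; set u := x - y.
have -> : reflection v c x - reflection v c y = u - (2 * dot u v / dot v v) *: v.
  rewrite /reflection opprD opprK addrACA -/u -!(scaleNr _ v) -scalerDl.
  by congr (_ + _ *: _); rewrite /u dotBl; field; rewrite gt_eqF.
by rewrite dot_subZ; field; rewrite gt_eqF.
Qed.

Lemma reflectionK v c : v != 0 -> involutive (reflection v c).
Proof.
move=> /dot_gt0 v0 x; rewrite {1}/reflection.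
set b := 2 * _ / _; rewrite /reflection -addrA -opprD -scalerDl.
rewrite [X in X *: v](_ : _ = 0) ?scale0r ?subr0//.
by rewrite /b /reflection dotBl dotZl; field; rewrite gt_eqF.
Qed.

End Euclid.

Section Isometries.
Context {R : realType} {n : nat}.
Implicit Types x y : 'cV[R]_n.+1.

(** The ambient norm, through which the topology is handled, is the maximum of the coordinates; this
    bound and the next transfer Euclidean isometries to it. *)
Lemma norm_le_enorm x : `|x| <= enorm x.
Proof.
apply/mx_norm_leP => [|i]; first exact: sqrtr_ge0.
rewrite -sqrtr_sqr ler_sqrt ?dot_ge0// /dot (bigD1 i)//= expr2 lerDl.
by apply: sumr_ge0 => j _; rewrite -expr2 sqr_ge0.
Qed.

Lemma enorm_le_norm x : enorm x <= n.+1%:R * `|x|.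
Proof.
have nx0 : 0 <= n.+1%:R * `|x| by rewrite mulr_ge0.
rewrite -[leRHS]ger0_norm// -sqrtr_sqr ler_sqrt ?sqr_ge0//.
apply: (@le_trans _ _ (\sum_(i < n.+1) `|x| ^+ 2)).
  apply: ler_sum => i _; rewrite -expr2 -real_normK ?num_real//.
  by rewrite lerXn2r ?nnegrE// le_coord_norm.
rewrite sumr_const card_ord exprMn -[leLHS]mulr_natl ler_wpM2r ?sqr_ge0//.
by rewrite expr2 ler_peMl// ler1n.
Qed.

(** An inverse is included so that these maps form a [transformation_group], which then contains any
    group generated by reflections. *)
Definition euclidean_isometries : set ('cV[R]_n.+1 -> 'cV[R]_n.+1) :=
  [set f | (forall x y, enorm (f x - f y) = enorm (x - y)) /\
           exists g, cancel f g /\ cancel g f].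

Lemma transformation_group_isometries : transformation_group euclidean_isometries.
Proof.
split.
- by split => //; exists id.
- move=> f g [fi [f' [fK f'K]]] [gi [g' [gK g'K]]]; split => [x y|].
    by rewrite /= fi gi.
  exists (g' \o f'); split => x; first by rewrite /= fK gK.
  by rewrite /= g'K f'K.
- move=> f [fi [f' [fK f'K]]]; exists f' => //; split; last by exists f.
  by move=> x y; rewrite -[LHS]fi !f'K.
Qed.

Lemma reflections_isometries (HH : set (set 'cV[R]_n.+1)) :
  reflections HH `<=` euclidean_isometries.
Proof.
move=> _ [v [c [v0 _ ->]]]; split=> [x y|]; first exact: reflection_isometry.
by exists (reflection v c); split; exact: reflectionK.
Qed.

Lemma isometry_lipschitz f x y : euclidean_isometries f ->
  `|f x - f y| <= n.+1%:R * `|x - y|.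
Proof.
by move=> [fi _]; rewrite (le_trans (norm_le_enorm _))// fi enorm_le_norm.
Qed.

Lemma isometry_continuous f : euclidean_isometries f -> continuous f.
Proof.
by move=> fi; apply: lipschitz_continuous => x y; exact: isometry_lipschitz.
Qed.

End Isometries.

Lemma generated_group_id {R : realType} {n : nat}
    (S : set ('cV[R]_n -> 'cV[R]_n)) : generated_group S id.
Proof. by move=> G [[]]. Qed.

Lemma generated_group_inv {R : realType} {n : nat}
    (S : set ('cV[R]_n -> 'cV[R]_n)) f g :
  generated_group S f -> cancel f g -> cancel g f -> generated_group S g.
Proof.
move=> Sf fK gK G GS; have [_ _ Ginv] := GS.1.
have [h Gh [_ hK]] := Ginv f (Sf G GS).
suff -> : g = h by [].
by apply/funext => x; rewrite -{1}[x]hK fK.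
Qed.

(** * Wavelet sets *)

Section CantorBernstein.
Context {T : Type} (f g : T -> T) (C F : set T).

(** The points of [C] with an ancestor under [g \o f] in [C] outside the image of [F]. They are to
    be moved by [f], the others by the inverse of [g]. *)
Definition cantor_bernstein_part : set T :=
  \bigcup_k iter k (fun X => g @` (f @` X)) (C `\` g @` F).

Lemma cantor_bernstein_part_sub :
  f @` C `<=` F -> g @` F `<=` C -> cantor_bernstein_part `<=` C.
Proof.
move=> fCF gFC x [k _]; elim: k x => [x [] //|k IH] _ /= [_ [x kx <-] <-].
by apply: gFC; exists (f x) => //; apply: fCF; exists x => //; exact: IH.
Qed.

Lemma cantor_bernstein_partD : injective g ->
  f @` C `<=` F -> g @` F `<=` C ->
  C `\` cantor_bernstein_part = g @` (F `\` f @` cantor_bernstein_part).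
Proof.
move=> gI fCF gFC; apply/seteqP; split=> [x [Cx nAx]|_ [y [Fy nfy] <-]].
  have [[y Fy yx]|ngx] := pselect ((g @` F) x); last first.
    by case: nAx; exists 0%N.
  exists y => //; split => // -[a [k _ ka] fa]; apply: nAx; exists k.+1 => //=.
  by exists y => //; exists a.
split; first by apply: gFC; exists y.
move=> [[|k] _ /=]; first by move=> [_]; apply; exists y.
move=> [_ [a ka <-] /gI fa]; apply: nfy; exists a => //; by exists k.
Qed.

End CantorBernstein.

(** * Groups of isometries with a fundamental domain *)

Section Weyl.
Context {R : realType} {n : nat}.
Local Notation V := 'cV[R]_n.+1.
Implicit Types (C : set V) (W : set (V -> V)).

Lemma rat_dense (X : set V) (x : V) : nbhs x X ->
  exists q : 'cV[rat]_n.+1, interior X (map_mx ratr q).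
Proof.
rewrite nbhsE => -[U [oU Ux] UX].
have /nbhs_ballP[e /= e0 xeU] := open_nbhs_nbhs (conj oU Ux).
have [q qP] : {q : 'I_n.+1 -> rat & forall i, x i 0 < ratr (q i) < x i 0 + e}.
  apply: (@choice _ _ (fun i r => x i 0 < ratr r < x i 0 + e)) => i.
  have : x i 0 < x i 0 + e by rewrite ltrDl.
  by move=> /rat_in_itvoo[r]; rewrite in_itv/=; exists r.
exists (\col_i q i); rewrite /interior/= nbhsE; exists U => //; split => //.
apply: xeU; split => // i j; rewrite (ord1 j) /ball/= ltr_distlC !mxE.
by have /andP[q1 q2] := qP i; apply/andP; split; lra.
Qed.

Lemma isometry_nbhs (f : V -> V) C (x : V) : euclidean_isometries f ->
  nbhs x C -> nbhs (f x) (f @` C).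
Proof.
move=> fI Cx; have [_ _ finv] := @transformation_group_isometries R n.
have [g gI [fK gK]] := finv f fI.
rewrite (can_image _ fK gK).
by apply: (isometry_continuous _ gI (f x)); rewrite fK.
Qed.

(** The interior of each image of [C] contains a rational point, and two distinct images cannot
    share one, since their overlap would not be null. *)
Lemma fundamental_domain_countable W C (x : V) :
  W `<=` euclidean_isometries -> fundamental_domain W C -> nbhs x C ->
  countable W.
Proof.
move=> WI [_ _ Wdisj] Cx.
have -> : W = \bigcup_(q in [set: 'cV[rat]_n.+1])
    [set f | W f /\ interior (f @` C) (map_mx ratr q)].
  apply/seteqP; split=> [f Wf|f [q _ []]//].
  have [q qf] := rat_dense _ _ (isometry_nbhs _ _ _ (WI f Wf) Cx).
  by exists q.
apply: bigcup_countable => // q _.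
have [[f0 [Wf0 qf0]]|nf] := pselect (exists f,
    W f /\ interior (f @` C) (map_mx ratr q)); last first.
  rewrite (_ : mkset _ = set0) //.
  by apply/seteqP; split=> // f Hf; apply: nf; exists f.
rewrite (_ : mkset _ = [set f0]) //.
apply/seteqP; split=> [f [Wf qf]|f ->//]; apply: contrapT => /= ff0.
have qI : nbhs (map_mx ratr q : V) ((f @` C) `&` (f0 @` C)) by exact: filterI.
have := lebesgue_outer_nbhs_gt0 _ _ qI.
by rewrite Wdisj// ltxx.
Qed.

(** A ball missed by all images of [C] would lie in a null set, yet balls have positive outer
    measure. *)
Lemma fundamental_domain_dense W C (p : V) (e : R) :
  fundamental_domain W C -> 0 < e ->
  exists w x, [/\ W w, C x & `|w x - p| < e].
Proof.
move=> [_ Wcov _] e0; apply: contrapT => nw.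
have := lebesgue_outer_nbhs_gt0 _ _ (nbhsx_ballx p e e0).
rewrite ltNge -Wcov lebesgue_outer_homo// => z pz [w Ww [x Cx wx]].
apply: nw; exists w, x; split => //; rewrite wx distrC.
by move: pz; rewrite mx_norm_ball.
Qed.

End Weyl.

(** * Congruence by two pieces *)

Section WaveletSet.
Context {R : realType} {n : nat}.
Local Notation V := 'cV[R]_n.+1.

Lemma null_set0 : Defs.null_set (set0 : set V).
Proof. exact: lebesgue_outer_set0. Qed.

Lemma ae_equal_refl (X : set V) : ae_equal X X.
Proof. by rewrite /ae_equal setYK; exact: null_set0. Qed.

(* The pieces of the congruence: [A] is carried to [w @` A] by [w] and
   the rest of [C] stays fixed; if [w = id], both pieces share an index. *)
Lemma group_congruent_two_pieces (W : set (V -> V)) (w w' : V -> V)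
    (A B : set V) : countable W -> W id -> W w' -> cancel w w' ->
  borel A -> borel B -> borel (w @` A) -> [disjoint A & B] ->
  [disjoint w @` A & B] ->
  group_congruent W (w @` A `|` B) (A `|` B).
Proof.
move=> cW Wid Ww' wK bA bB bwA AB wAB.
(* The index is the map from the first set to the second, hence [w'] and not [w]; indices other than
   [w'] and [id] get the empty piece. *)
pose P (X Y : set V) (h : V -> V) : set V :=
  [set x | h = w' /\ X x \/ h = id /\ Y x].
have PU X Y : \bigcup_(h in W) P X Y h = X `|` Y.
  apply/seteqP; split=> [x [h _ [[_ ?]|[_ ?]]]|x [Xx|Yx]];
    [by left|by right| |].
    by exists w' => //; left.
  by exists id => //; right.
have Pdisj X Y h k : [disjoint X & Y] -> h <> k ->
    Defs.null_set (P X Y h `&` P X Y k).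
  move=> /disj_setPS XY hk; rewrite (_ : _ `&` _ = set0); first exact: null_set0.
  apply/seteqP; split=> // x [[[h1 h2]|[h1 h2]] [[k1 k2]|[k1 k2]]].
  - by apply: hk; rewrite h1.
  - exact: (XY x).
  - exact: (XY x).
  - by apply: hk; rewrite h1.
have bP X Y h : borel X -> borel Y -> borel (P X Y h).
  move=> bX bY; have b0 : borel (set0 : set V) by apply: open_borel; exact: open0.
  have bif (c : Prop) (Z : set V) : borel Z -> borel [set x | c /\ Z x].
    move=> bZ; have [cT|cF] := pselect c.
      by rewrite (_ : mkset _ = Z)//; apply/seteqP; split=> x // [].
    by rewrite (_ : mkset _ = set0)//; apply/seteqP; split=> x // [].
  by apply: borelU; exact: bif.
exists (P (w @` A) B), (P A B); split.
- split=> // [h _|h k _ _|]; first by apply: borel_measurable; exact: bP.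
    exact: Pdisj.
  by rewrite PU; exact: ae_equal_refl.
- split=> // [h _|h k _ _|]; first by apply: borel_measurable; exact: bP.
    exact: Pdisj.
  by rewrite PU; exact: ae_equal_refl.
- move=> h _; rewrite (_ : P A B h = h @` P (w @` A) B h).
    exact: ae_equal_refl.
  apply/seteqP; split=> [x [[-> Ax]|[-> Bx]]|_ [x [[-> [a Aa <-]]|[-> Bx]] <-]].
  - by exists (w x); rewrite ?wK//; left; split => //; exists x.
  - by exists x => //; right.
  - by left; rewrite wK.
  - by right.
Qed.

End WaveletSet.

(** * Construction of the wavelet set *)

Theorem theorem7p4 (R : realType) (n : nat) (n_gt0 : (0 < n)%N)
    (C : set 'cV[R]_n) (W : set ('cV[R]_n -> 'cV[R]_n))
    (theta : 'cV[R]_n) (A : 'M[R]_n)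
    (foldC : foldable_figure C)
    (weylW : affine_weyl_group_of C W)
    (theta_int : interior C theta)
    (expA : expansive A) :
  exists E : set 'cV[R]_n,
    [/\ lebesgue_measurable E,
        group_congruent W E C &
        measurable_partition [set: int]
          (fun k : int => dilation_iter A theta k @` E) [set: 'cV[R]_n]].
Proof.
case: n n_gt0 C W theta A foldC weylW theta_int expA => // n _ C W theta A.
move=> [compC _ _ _] [_ Wgen fundC] Ctheta expA.
have uA := expA.1.
set D := dilation_iter A theta.
have DD k l x : D (k + l) x = D k (D l x) by exact: dilation_iterD.
have DK k : cancel (D k) (D (- k)) by exact: dilation_iterK.
have DNK k : cancel (D (- k)) (D k) by exact: dilation_iterNK.
have cD k : continuous (D k) by exact: continuous_dilation_iter.
have WI : W `<=` euclidean_isometries.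
  rewrite Wgen; apply: smallest_sub; last exact: reflections_isometries.
  exact: transformation_group_isometries.
have cW := fundamental_domain_countable _ _ _ WI fundC Ctheta.
have bC : borel C by apply: closed_borel;
  exact: (compact_closed (@norm_hausdorff _ _)).
have [F [bF Fcov Funiq Fsmall Fbig]] := dilation_tile A theta expA.
have [j DjF] : exists j, D (- j) @` F `<=` C.
  have /nbhs_ballP[e /= e0 Ce] := Ctheta.
  have [j Fj] := Fsmall e e0; exists j => _ [x Fx <-]; apply: Ce.
  by rewrite mx_norm_ball /ball_/= distrC; exact: Fj.
have [d d0 Cd] : exists2 d, 0 < d & forall x y, C x -> C y -> `|x - y| <= d.
  have [M [_ MC]] := compact_bounded compC.
  exists (2 * (`|M| + 1)); first by rewrite mulr_gt0// ltr_wpDl.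
  have CM x : C x -> `|x| <= `|M| + 1.
    by apply: MC; rewrite (le_lt_trans (ler_norm M))// ltrDl.
  move=> x y /CM Mx /CM My; rewrite (le_trans (ler_normB _ _))//; lra.
(* In the maximum norm [w] expands distances at most by the factor [n.+1], so [w C] has diameter at
   most [n.+1 * d]; the summand 1 is the distance allowed from [p] to [w x0]. *)
have [|k [p pF]] := Fbig (n.+1%:R * d + 1).
  by rewrite ltr_wpDl// mulr_ge0// ltW.
have [w [x0 [Ww Cx0 wx0]]] := fundamental_domain_dense _ _ p _ fundC (@ltr01 R).
have wCF : D (- k) @` (w @` C) `<=` F.
  move=> _ [_ [x Cx <-] <-]; apply: pF.
  rewrite -[w x](subrK (w x0)) -addrA (le_trans (ler_normD _ _))// lerD//.
    rewrite (le_trans (isometry_lipschitz _ _ _ (WI w Ww)))// ler_wpM2l//.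
    exact: Cd.
  exact: ltW.
have [_ [w' [wK w'K]]] := WI w Ww.
have Ww' : W w'.
  by rewrite Wgen; apply: (generated_group_inv _ _ _ _ wK w'K); rewrite -Wgen.
have cw := isometry_continuous _ (WI w Ww).
have cw' := isometry_continuous _ (WI w' Ww').
pose f x := D (- k) (w x).
have fCF : f @` C `<=` F.
  by move=> _ [x Cx <-]; apply: wCF; exists (w x) => //; exists x.
pose B := cantor_bernstein_part f (D (- j)) C F.
pose P := f @` B.
have BC : B `<=` C by exact: cantor_bernstein_part_sub.
have CBE : C `\` B = D (- j) @` (F `\` P).
  by apply: cantor_bernstein_partD => //; exact: can_inj (DNK j).
have bw X : borel X -> borel (w @` X) by exact: (borel_image w w').
have bD m X : borel X -> borel (D m @` X).
  by apply: (borel_image _ _ _ (DK m) (DNK m)); exact: cD.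
have bB : borel B.
  apply: borel_bigcup; elim=> [|i bi] /=.
    by apply: borelD => //; exact: bD.
  by apply: (bD); rewrite -[f]/(D (- k) \o w) -image_comp; apply: bD; exact: bw.
have bCB : borel (C `\` B) by exact: borelD.
(* As [w B = D^k P] and [C \ B = D^-j (F \ P)], each point of [F] is moved along its own orbit, so
   [E] inherits the transversality of [F]. *)
pose E := w @` B `|` (C `\` B).
have bE : borel E by apply: borelU => //; exact: bw.
have wBP x : (w @` B) x -> F (D (- k) x) /\ P (D (- k) x).
  move=> [b Bb <-]; split; last by exists b.
  by apply: fCF; exists b => //; exact: BC.
have CBP x : (C `\` B) x -> F (D j x) /\ ~ P (D j x).
  by rewrite CBE => -[y Fy <-]; rewrite DNK.
exists E; split.
- exact: borel_measurable.
- have CU : C = B `|` (C `\` B).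
    apply/seteqP; split=> [x Cx|x [/BC//|[]//]].
    by have [?|?] := pselect (B x); [left|right].
  rewrite [X in group_congruent _ _ X]CU.
  apply: (group_congruent_two_pieces _ _ _ _ _ cW _ Ww' wK) => //.
  + by rewrite Wgen; exact: generated_group_id.
  + exact: bw.
  + by apply/disj_setPS => x [? []].
  (* Such an [x] would meet [F] at the exponents [- k] and [j], which must agree, with the same
     point both in [P] and outside it. *)
  + apply/disj_setPS => x [/wBP[F1 P1] /CBP[F2 P2]]; apply: P2.
    by rewrite (Funiq _ _ _ F2 F1).
- split=> //.
  + by move=> m _; apply: borel_measurable; exact: bD.
  + move=> a b _ _ ab; rewrite (_ : _ `&` _ = set0); first exact: null_set0.
    apply/seteqP; split=> // _ [[u Eu <-] [v Ev /(congr1 (D (- a)))]].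
    rewrite DK -DD => uE; apply: ab.
    (* Here [u] and [v] share an orbit, hence its only point in [F]. Whether that point is in [P]
       decides which piece of [E] holds [u] and [v]: the mixed cases are contradictory, the others
       give [a = b]. *)
    have key m : D m u = D (m - a + b) v by rewrite -uE -DD addrA.
    have eab m : m - a + b = m -> a = b.
      move=> h; apply: (addrI m).
      by rewrite -{1}h -addrA (addrC b) addrA subrK.
    move: Eu Ev => [/wBP[F1 P1]|/CBP[F1 P1]] [/wBP[F2 P2]|/CBP[F2 P2]];
      rewrite key in F1 P1; have e := Funiq _ _ _ F1 F2.
    * exact: eab e.
    * by rewrite e in P1.
    * by rewrite e in P1.
    * exact: eab e.
  (* If [D m x] lies in [F], then [D (k + m) x] or [D (- j + m) x] lies in [E], according to whether
     [D m x] is in [P] or not. *)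
  + have sub : ~` (\bigcup_i (D i @` E)) `<=` [set theta].
      move=> x nx; apply: contrapT => /Fcov[m Fm]; apply: nx.
      have [Pm|nPm] := pselect (P (D m x)).
        have [b Bb bm] := Pm; exists (- (k + m)) => //.
        exists (D k (D m x)); last by rewrite -(DD k m) DK.
        by left; exists b => //; rewrite -bm /f DNK.
      exists (- (- j + m)) => //; exists (D (- j) (D m x));
        last by rewrite -(DD (- j) m) DK.
      by right; rewrite CBE; exists (D m x).
    apply/eqP; rewrite eq_le lebesgue_outer_ge0 andbT.
    rewrite -(lebesgue_outer_set1 theta); apply: lebesgue_outer_homo => x.
    by case=> [[_ /(_ I)]|[_ /sub]].
Qed.
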